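(* Let $p$ be a real number. The solution $X=1+x_1+x_2+\cdots$ (a formal sum of elements of $\mathcal H_K$, with $x_i$ homogeneous of degree $i$) of the combinatorial Dyson-Schwinger equation $$X=1+B_+(X^p)$$ in $\mathcal H_K$ is given by $$x_n=\sum_{t\in\mathcal T_{n-1}}e(t)\,C_p(t)\,t\qquad(n\ge1),$$ where $e(t)$ is the number of planar rooted trees $T$ such that $\rho(T)=t$.
   Context: The base field $k$ has characteristic $0$ and is taken to contain $\mathbb R$. A rooted tree is a finite poset with a unique maximal element (the root) such that for each element (vertex) $v$ the set of elements exceeding $v$ is a chain; rooted trees are considered up to isomorphism, $|t|$ is the number of vertices, $\mathcal T$ is the set of rooted trees and $\mathcal T_n=\{t\in\mathcal T:|t|=n+1\}$. The Connes-Kreimer Hopf algebra $\mathcal H_K$ is, as an algebra, the free commutative $k$-algebra $S(k\mathcal T)$ on rooted trees (with basis the forests, i.e. commutative monomials in rooted trees), graded by $|t_1\cdots t_k|=|t_1|+\cdots+|t_k|$. $B_+$ is the linear map sending a forest $t_1\cdots t_k$ to the rooted tree obtained by attaching a new root vertex to each of the roots of $t_1,\dots,t_k$, with $B_+(1)=\bullet$ (the one-vertex tree); it is extended to formal sums degree by degree. With $\bar X=x_1+x_2+\cdots$, $X^p$ means $(1+\bar X)^p=\sum_{k\ge0}\binom pk\bar X^k$, where $\binom pk=\frac{p(p-1)\cdots(p-k+1)}{k!}$. For a (planar or non-planar) rooted tree $t$, $C_p(t)=\prod_{v}\binom{p}{c(v)}$, the product being over the vertices $v$ of $t$ with $c(v)\ne0$,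 where $c(v)$ is the number of children of $v$ (so $C_p(\bullet)=1$). A planar rooted tree is a rooted tree with a linear order on the children of each vertex (up to isomorphism), and $\rho(T)$ denotes the rooted tree underlying the planar rooted tree $T$ (forgetting the orders). *)

(* Defs.v *)
From HB Require Import structures.
From mathcomp Require Import all_boot all_algebra.
From mathcomp Require Import generic_quotient finmap.
From mathcomp Require Import boolp classical_sets cardinality fsbigop reals.
From mathcomp Require Import monalg.

Set Implicit Arguments.
Unset Strict Implicit.
Unset Printing Implicit Defensive.

Import GRing.Theory.
Local Open Scope ring_scope.

Record finRel := FinRel { vertex :> finType; rle : rel vertex }.

Definition is_order (P : finRel) : Prop :=
  [/\ reflexive (@rle P), antisymmetric (@rle P) & transitive (@rle P)].

Definition rlt (P : finRel) (u v : P) : bool := (u != v) && rle u v.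

Definition is_maximal (P : finRel) (r : P) : Prop :=
  forall v : P, ~~ rlt r v.

Definition exceeding_chain (P : finRel) : Prop :=
  forall v a b : P, rlt v a -> rlt v b -> rle a b || rle b a.

Definition is_rooted_tree (P : finRel) : Prop :=
  [/\ is_order P, exists! r : P, is_maximal r & exceeding_chain P].

Definition isom (P Q : finRel) : Prop :=
  exists2 f : P -> Q, bijective f & forall u v, rle (f u) (f v) = rle u v.

(** [is_child v u] : [u] is a child of [v], i.e. [v] covers [u]. *)
Definition is_child (P : finRel) (v u : P) : bool :=
  rlt u v && ~~ [exists w : P, rlt u w && rlt w v].

Definition nchildren (P : finRel) (v : P) : nat := #|[set u | is_child v u]|.

Definition gbinom (k : fieldType) (p : k) (n : nat) : k :=
  (\prod_(i < n) (p - i%:R)) / (n`!)%:R.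

Definition Cp (k : fieldType) (p : k) (P : finRel) : k :=
  \prod_(v : P | nchildren v != 0%N) gbinom p (nchildren v).

(** The list gives the linear order on the children of the root; equality in
    this type is isomorphism of planar rooted trees. *)
Inductive ptree := PNode of seq ptree.

Fixpoint ptree_encode (T : ptree) : GenTree.tree void :=
  let: PNode s := T in GenTree.Node 0 (map ptree_encode s).

Fixpoint ptree_decode (T : GenTree.tree void) : ptree :=
  if T is GenTree.Node _ s then PNode (map ptree_decode s) else PNode [::].

Lemma ptree_encodeK : cancel ptree_encode ptree_decode.
Proof.
rewrite /cancel; fix IH 1 => -[s] /=; congr PNode; rewrite -map_comp.
by elim: s => [|t s IHs] //=; rewrite IH IHs.
Qed.

HB.instance Definition _ := Countable.copy ptree (can_type ptree_encodeK).

Definition rel_empty : finRel := @FinRel void (fun _ _ => true).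

Definition rel_sum (P Q : finRel) : finRel :=
  @FinRel (P + Q)%type (fun u v => match u, v with
    | inl u, inl v => rle u v
    | inr u, inr v => rle u v
    | _, _ => false
    end).

(** [None] is the added root, i.e. the added maximum. *)
Definition rel_root (P : finRel) : finRel :=
  @FinRel (option P) (fun u v => match u, v with
    | _, None => true
    | None, Some _ => false
    | Some u, Some v => rle u v
    end).

Fixpoint ptree_rel (T : ptree) : finRel :=
  let: PNode s := T in
  rel_root (foldr (fun t P => rel_sum (ptree_rel t) P) rel_empty s).

Lemma isom_refl P : isom P P.
Proof. by exists id => //; exists id. Qed.

Lemma isom_sym P Q : isom P Q -> isom Q P.
Proof.
move=> [f [g fK gK] fP]; exists g; first by exists f.
by move=> u v; rewrite -fP !gK.
Qed.

Lemma isom_trans P Q S : isom P Q -> isom Q S -> isom P S.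
Proof.
move=> [f fb fP] [g gb gP]; exists (g \o f); first exact: bij_comp.
by move=> u v; rewrite /= gP fP.
Qed.

Definition ptree_isom (T T' : ptree) : bool :=
  `[< isom (ptree_rel T) (ptree_rel T') >].

Lemma ptree_isom_equiv : equiv_class_of ptree_isom.
Proof.
split=> [T|T T'|T T' T''].
- exact/asboolP/isom_refl.
- by apply/asboolP/asboolP => /isom_sym.
- by move=> /asboolP h1 /asboolP h2; apply/asboolP; apply: isom_trans h1 h2.
Qed.

Canonical ptree_isom_equivRel := EquivRelPack ptree_isom_equiv.

(** Isomorphism classes of rooted trees. Every rooted tree carries a planar
    structure, so it is enough to take the classes of the posets [ptree_rel T]:
    see [ptree_rel_rooted_tree], [rooted_tree_planar], [rooted_tree_class]. *)
Definition rtree := {eq_quot ptree_isom}%qT.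
HB.instance Definition _ := Choice.on rtree.
HB.instance Definition _ := EqQuotient.on rtree.

Definition rho (T : ptree) : rtree := (\pi_rtree T)%qT.

Definition rtree_rel (t : rtree) : finRel := ptree_rel (repr t).

Definition rsize (t : rtree) : nat := #|rtree_rel t|.

Definition rtrees (n : nat) : set rtree := [set t | rsize t = n.+1].

Definition planar_count (t : rtree) : nat :=
  #|` fset_set [set T : ptree | rho T = t] |%fset.

Definition is_forest (P : finRel) : Prop := is_order P /\ exceeding_chain P.

Definition forest_rel (s : seq ptree) : finRel :=
  foldr (fun t P => rel_sum (ptree_rel t) P) rel_empty s.

Lemma isom_sum P P' Q Q' :
  isom P P' -> isom Q Q' -> isom (rel_sum P Q) (rel_sum P' Q').
Proof.
move=> [f [f' fK f'K] fP] [g [g' gK g'K] gP].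
exists (fun u : rel_sum P Q => match u with
  inl x => inl (f x) | inr y => inr (g y) end : rel_sum P' Q').
- exists (fun u : rel_sum P' Q' => match u with
    inl x => inl (f' x) | inr y => inr (g' y) end : rel_sum P Q).
  + by case=> x; rewrite ?fK ?gK.
  + by case=> x; rewrite ?f'K ?g'K.
- by case=> x [] y /=.
Qed.

Lemma isom_root P P' : isom P P' -> isom (rel_root P) (rel_root P').
Proof.
move=> [f [f' fK f'K] fP].
exists (omap f : rel_root P -> rel_root P').
  by exists (omap f' : rel_root P' -> rel_root P); case=> //= x; rewrite ?fK ?f'K.
by case=> [x|] [y|] /=.
Qed.

Lemma isom_rooted_tree P Q : isom P Q -> is_rooted_tree P -> is_rooted_tree Q.
Proof.
move=> [f [g fK gK] fP] [[Pr Pa Pt] [r [rm ru]] Pc].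
have gP u v : rle (g u) (g v) = rle u v by rewrite -fP !gK.
have gI : injective g := can_inj gK.
have gL u v : rlt (g u) (g v) = rlt u v by rewrite /rlt gP (inj_eq gI).
split; first split.
- by move=> u; rewrite -gP Pr.
- by move=> u v; rewrite -!gP => /Pa/gI.
- by move=> v u w; rewrite -!gP; apply: Pt.
- exists (f r); split=> [v|s sm]; first by rewrite -gL fK; apply: rm.
  apply: (can_inj gK); rewrite fK; apply: ru => v.
  by rewrite -[v]fK gL; apply: sm.
- by move=> v a b; rewrite -!gL -!gP; apply: Pc.
Qed.

Lemma forest_root P : is_forest P -> is_rooted_tree (rel_root P).
Proof.
move=> [[Pr Pa Pt] Pc]; split; first split.
- by case=> [x|] //=.
- by move=> [x|] [y|] //= /Pa ->.
- by move=> [x|] [y|] [z|] //=; apply: Pt.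
- exists None; split; first by case.
  by case=> [x|] // /(_ None).
- move=> [x|] [a|] [b|]; rewrite /rlt //= => /andP[xa la] /andP[xb lb].
  by apply: (Pc x); rewrite /rlt ?la ?lb andbT.
Qed.

Lemma forest_sum P Q :
  is_forest P -> is_forest Q -> is_forest (rel_sum P Q).
Proof.
move=> [[Pr Pa Pt] Pc] [[Qr Qa Qt] Qc]; split; first split.
- by case=> x /=.
- by move=> [x|x] [y|y] //= => [/Pa|/Qa] ->.
- by move=> [x|x] [y|y] [z|z] //=; [apply: Pt | apply: Qt].
- move=> [x|x] [a|a] [b|b]; rewrite /rlt ?andbF //=.
  + by move=> /andP[? ?] /andP[? ?]; apply: (Pc x); apply/andP.
  + by move=> /andP[? ?] /andP[? ?]; apply: (Qc x); apply/andP.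
Qed.

Lemma ptree_rel_rooted_tree (T : ptree) : is_rooted_tree (ptree_rel T).
Proof.
move: T; fix IH 1 => -[s] /=; apply: forest_root.
elim: s => [|t s IHs] /=; first by split; [split=> -[] | case].
by apply: forest_sum => //; case: (IH t).
Qed.

Definition rel_sub (P : finRel) (A : pred P) : finRel :=
  @FinRel {x : P | A x} (fun u v => rle (val u) (val v)).

Lemma forest_sub (P : finRel) (A : pred P) : is_forest P -> is_forest (rel_sub A).
Proof.
move=> [[Pr Pa Pt] Pc]; split; first split.
- by move=> x /=.
- by move=> x y /= /Pa /val_inj.
- by move=> y x z; apply: Pt.
- by move=> x a b; rewrite /rlt -!val_eqE; apply: Pc.
Qed.

Lemma exists_maximal (P : finRel) (x : P) :
  is_order P -> exists r : P, is_maximal r.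
Proof.
move=> [Pr Pa Pt].
case: (@arg_maxnP _ x predT (fun r => #|[set u : P | rle u r]|)) => // r _ rP.
exists r => v; apply/negP => /andP[nrv lrv].
have := rP v isT; rewrite /= leqNgt => /negP; apply; apply: proper_card.
apply/properP; split.
  by apply/fintype.subsetP => u; rewrite !inE => /Pt; apply.
exists v; rewrite !inE ?Pr //; apply/negP => lvr.
by case/eqP: nrv; apply: Pa; rewrite lrv.
Qed.

Lemma surj_inj_bij (A B : finType) (f : A -> B) :
  injective f -> (forall y, exists x, f x = y) -> bijective f.
Proof.
move=> fI fS; apply: inj_card_bij => //.
rewrite -(card_codom fI); apply/subset_leq_card/fintype.subsetP => y _.
by have [x <-] := fS y; apply: codom_f.
Qed.

Lemma forest_planar n (P : finRel) : (#|P| < n)%N -> is_forest P ->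
  exists s, isom P (forest_rel s).
Proof.
elim: n P => [|n IHn] P //; rewrite ltnS => Pn Pf.
have [[Pr Pa Pt] Pc] := Pf.
have [x _|P0] := pickP (@predT P); last first.
  exists [::]; have P00 (u : P) : False by have := P0 u.
  exists (fun u : P => False_rect void (P00 u)); last by move=> u; case: (P00 u).
  by exists (fun v : void => match v return P with end) => [u|[]]; case: (P00 u).
have [r rm] := exists_maximal x (And3 Pr Pa Pt).
have {}rm v : rle r v -> v = r.
  move=> lrv; apply/eqP; apply: contraT => nvr.
  by have := rm v; rewrite /rlt lrv andbT eq_sym nvr.
pose A := [pred u : P | (u != r) && rle u r].
pose B := [pred u : P | ~~ rle u r].
have sub_small (C : pred P) : ~~ C r -> (#|rel_sub C| < n)%N.
  move=> nCr; apply: leq_trans Pn.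
  rewrite /rel_sub /= card_sig; apply: proper_card.
  by apply/properP; split; [apply/fintype.subsetP | exists r].
have [s1 i1] : exists s, isom (rel_sub A) (forest_rel s).
  by apply: IHn; [apply: sub_small; rewrite /= eqxx | apply: forest_sub].
have [s2 i2] : exists s, isom (rel_sub B) (forest_rel s).
  by apply: IHn; [apply: sub_small; rewrite /= Pr | apply: forest_sub].
exists (PNode s1 :: s2).
apply: isom_trans (isom_sum (isom_root i1) i2).
apply: isom_sym.
exists (fun u : rel_sum (rel_root (rel_sub A)) (rel_sub B) =>
  match u with
  | inl None => r | inl (Some a) => val a | inr b => val b
  end).
  apply: surj_inj_bij.
    move=> [[[a Aa]|]|[b Bb]] [[[c Ac]|]|[d Bd]] //= e.
    - by congr (inl (Some _)); apply: val_inj.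
    - by exfalso; case/andP: (Aa) => /=; rewrite e eqxx.
    - by exfalso; case/negP: (Bd); rewrite -e; case/andP: (Aa).
    - by exfalso; case/andP: (Ac) => /=; rewrite e eqxx.
    - by exfalso; case/negP: (Bd); rewrite -e Pr.
    - by exfalso; case/negP: (Bb); rewrite e; case/andP: (Ac).
    - by exfalso; case/negP: (Bb); rewrite e Pr.
    - by congr inr; apply: val_inj.
  move=> y; have [ly|ly] := boolP (rle y r); last by exists (inr (Sub y ly)).
  have [->|yr] := eqVneq y r; first by exists (inl None).
  have Ay : A y by rewrite /= yr.
  by exists (inl (Some (Sub y Ay))).
have AB a b : A a -> B b -> rle a b = false.
  move=> /andP[/= ar la] /= lb; apply/negP => lab.
  have ab : a != b by apply/eqP => e; rewrite -e la in lb.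
  have /orP[lbr|/rm e] : rle b r || rle r b.
    by apply: (Pc a); rewrite /rlt ?ab ?ar.
    by rewrite lbr in lb.
  by rewrite e Pr in lb.
have BA a b : A a -> B b -> rle b a = false.
  by move=> /andP[/= _ la] /= lb; apply/negP => /Pt /(_ la); apply/negP.
move=> [[[a Aa]|]|[b Bb]] [[[c Ac]|]|[d Bd]] //=.
- by case/andP: Aa.
- exact: AB.
- by apply/negP => /rm e; case/andP: (Ac) => /=; rewrite e eqxx.
- exact: Pr.
- by apply/negP => /rm e; move: Bd; rewrite /= e Pr.
- exact: BA.
- exact/negbTE.
Qed.

Lemma rooted_tree_planar (P : finRel) :
  is_rooted_tree P -> exists T : ptree, isom P (ptree_rel T).
Proof.
move=> [PO [r [rm ru]] Pc].
have [s i] := @forest_planar #|P|.+1 P (leqnn _) (conj PO Pc).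
case: s i => [|t [|t' s]] i.
- by case: i => f; case: (f r).
- exists t; apply: isom_trans i _.
  exists (fun u : forest_rel [:: t] => match u with
    inl x => x | inr v => match v with end end).
    by exists (fun x => inl x); [case=> [|[]] | ].
  by move=> [u|[]] [v|[]].
- have [f [g fK gK] fP] := i.
  have rootP T : exists v : ptree_rel T, is_maximal v.
    by have [_ [v [vm _]] _] := ptree_rel_rooted_tree T; exists v.
  have [[v vm] [w wm]] := (rootP t, rootP t').
  have fL a b : rlt (f a) (f b) = rlt a b by rewrite /rlt fP (can_eq fK).
  have gm y : is_maximal y -> r = g y.
    by move=> ym; apply: ru => u; rewrite -fL gK; apply: ym.
  have : g (inl v) = g (inr (inl w)).
    rewrite -(gm (inl v)) => [|[u|u]]; [|exact: vm|by rewrite /rlt andbF].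
    apply: gm => -[u|[u|u]]; [by rewrite /rlt andbF|exact: wm|].
    by rewrite /rlt andbF.
  by move/(can_inj gK).
Qed.

Lemma rtree_rel_rooted_tree (t : rtree) : is_rooted_tree (rtree_rel t).
Proof. exact: ptree_rel_rooted_tree. Qed.

Lemma rho_rel (T : ptree) : isom (rtree_rel (rho T)) (ptree_rel T).
Proof.
by apply/asboolP; have /eqquotP := reprK (rho T).
Qed.

Lemma rooted_tree_class (P : finRel) :
  is_rooted_tree P -> exists! t : rtree, isom P (rtree_rel t).
Proof.
move=> /rooted_tree_planar[T i]; exists (rho T); split.
  exact: isom_trans i (isom_sym (rho_rel T)).
move=> t j; rewrite -[t]reprK; apply/eqquotP/asboolP.
exact: isom_trans (isom_sym i) j.
Qed.

(** The sets of trees counted and summed over are finite, so that [fset_set]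
    and the finitely supported sums over [rtrees n] are not degenerate. *)
Lemma isom_card P Q : isom P Q -> #|P| = #|Q|.
Proof. by move=> [f fb _]; apply: bij_eq_card fb. Qed.

Lemma ptrees_bounded n :
  exists L : seq ptree, forall T, (#|ptree_rel T| <= n)%N -> T \in L.
Proof.
elim: n => [|n [L LP]].
  by exists [::] => T; case: T => s; rewrite /= card_option.
have ES j : exists S : seq (seq ptree),
    forall s, (size s <= j)%N -> all (mem L) s -> s \in S.
  elim: j => [|j [S SP]]; first by exists [:: [::]]; case.
  exists ([::] :: [seq t :: s | t <- L, s <- S]); case=> [|t s] //=.
  move=> sj /andP[tL sL]; rewrite inE /=.
  by apply: allpairs_f => //; apply: SP.
have [S SP] := ES n; exists [seq PNode s | s <- S] => T; case: T => s; rewrite /= card_option ltnS => sn.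
apply: map_f; apply: SP.
  apply: leq_trans sn; elim: s => //= t s IHs; rewrite card_sum -add1n leq_add //.
  by case: t => s'; rewrite /= card_option.
elim: s sn => //= t s IHs; rewrite card_sum => sn; apply/andP; split.
  by apply: LP; apply: leq_trans sn; apply: leq_addr.
by apply: IHs; apply: leq_trans sn; apply: leq_addl.
Qed.

Lemma finite_planar (t : rtree) : finite_set [set T : ptree | rho T = t].
Proof.
have [L LP] := ptrees_bounded (rsize t).
apply: sub_finite_set (finite_seq L) => T /= Tt.
by apply: LP; rewrite -(isom_card (rho_rel T)) Tt.
Qed.

Lemma finite_rtrees n : finite_set (rtrees n).
Proof.
have [L LP] := ptrees_bounded n.+1.
apply: sub_finite_set (finite_seq (map rho L)) => t tn /=.
have <- : rho (repr t) = t by rewrite /rho reprK.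
by apply: map_f; apply: LP; rewrite -tn.
Qed.

Definition forest := {cmonom rtree}.

Definition fsize (m : forest) : nat :=
  (\sum_(t <- finsupp m) m t * rsize t)%N.

Definition forest_seq (m : forest) : seq rtree :=
  flatten [seq nseq (m t) t | t <- finsupp m].

Definition graft (m : forest) : rtree :=
  rho (PNode [seq repr t | t <- forest_seq m]).

(** The free commutative algebra on [rtree]: its basis is the free commutative
    monoid on [rtree]. *)
Definition CK (k : fieldType) := {malg k[forest]}.
HB.instance Definition _ (k : fieldType) := GRing.ComAlgebra.on (CK k).

Definition tree (k : fieldType) (t : rtree) : CK k :=
  (<< (ucm t : forest) >> : {malg k[forest]}).

Definition Bplus (k : fieldType) (f : CK k) : CK k :=
  \sum_(m <- msupp f) f@_m *: tree k (graft m).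

Definition homogeneous (k : fieldType) (n : nat) (f : CK k) : Prop :=
  forall m, m \in msupp f -> fsize m = n.

(** The formal sum [f 0 + f 1 + ...], with [f n] homogeneous of degree [n], is
    encoded as the sequence of its components. *)

Section FormalSums.
Variable k : fieldType.
Implicit Types f g : nat -> CK k.

Definition fs_one : nat -> CK k := fun n => (n == 0%N)%:R.

Definition fs_add f g : nat -> CK k := fun n => f n + g n.

Definition fs_mul f g : nat -> CK k :=
  fun n => \sum_(i < n.+1) f i * g (n - i)%N.

Definition fs_exp f (j : nat) : nat -> CK k := iter j (fs_mul f) fs_one.

Definition fs_bar f : nat -> CK k := fun n => if n == 0%N then 0 else f n.

(** The sum over all [j] of [gbinom p j *: (fs_bar X) ^ j]; in degree [n] only
    the terms with [j <= n] contribute, by [fs_exp_bar]. *)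
Definition fs_power (p : k) (X : nat -> CK k) : nat -> CK k :=
  fun n => \sum_(j < n.+1) gbinom p j *: fs_exp (fs_bar X) j n.

Lemma fs_exp_bar f (j n : nat) : (n < j)%N -> fs_exp (fs_bar f) j n = 0.
Proof.
elim: j n => // j IHj n nj; rewrite /fs_exp iterS /fs_mul big1 // => i _.
have [i0|i0] := eqVneq (i : nat) 0%N; first by rewrite /fs_bar i0 mul0r.
rewrite [X in _ * X]IHj ?mulr0 //.
apply: (@leq_trans n) => //; rewrite ltn_subrL lt0n i0 /=.
by apply: (@leq_trans i); rewrite ?lt0n // -ltnS.
Qed.

Definition fs_Bplus f : nat -> CK k :=
  fun n => if n is m.+1 then Bplus (f m) else 0.

Definition DSE_solution (p : k) (X : nat -> CK k) : Prop :=
  [/\ forall n, homogeneous n (X n),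
      X 0%N = 1 &
      X = fs_add fs_one (fs_Bplus (fs_power p X))].

End FormalSums.

(* Main.v *)
(** Indexing the sums by planar trees turns the formula for [x_n] into the sum of
    [C_p(T) rho(T)] over all planar trees [T] with [n] vertices, since [e(t)]
    counts the planar trees above [t]. A planar tree is a root followed by a
    sequence of [j] planar trees, and [C_p] picks up the factor [binom(p, j)] at
    the root. Hence [B_+] of the degree [n] part of
    [sum_j binom(p, j) \bar X^j], expanded over sequences of planar trees,
    is exactly the sum over planar trees with [n + 1] vertices. As the equation
    determines [x_(n+1)] from [x_1, ..., x_n], this solution is the only one. *)

Require Import Defs.
From mathcomp Require Import all_boot all_algebra.
From mathcomp Require Import generic_quotient finmap.
From mathcomp Require Import boolp classical_sets cardinality fsbigop reals.
From mathcomp Require Import monalg.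

Set Implicit Arguments.
Unset Strict Implicit.
Unset Printing Implicit Defensive.

Import GRing.Theory.
Local Open Scope ring_scope.

(** * Numbers of children and the recursion for [Cp] *)

Lemma big_option (R : Type) (idx : R) (op : Monoid.com_law idx) (T : finType)
    (F : option T -> R) :
  \big[op/idx]_u F u = op (F None) (\big[op/idx]_(u : T) F (Some u)).
Proof.
rewrite (perm_big (None :: map Some (index_enum T))) ?big_cons ?big_map //.
apply: uniq_perm; rewrite ?index_enum_uniq //=.
  rewrite map_inj_uniq ?index_enum_uniq ?andbT; last exact: Some_inj.
  by apply/mapP => -[].
case=> [u|]; rewrite !mem_index_enum ?inE //=.
by rewrite mem_map ?mem_index_enum //; apply: Some_inj.
Qed.

(** Covering below [f v] is tested only by elements below [f v], and these all lie in the image of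
    [f]. This serves isomorphisms, the two summands of [rel_sum] and the inclusion of [P] in
    [rel_root P]. *)
Lemma nchildren_embed (P Q : finRel) (f : P -> Q) (v : P) :
    injective f -> (forall a b, rle (f a) (f b) = rle a b) ->
    (forall w, rle w (f v) -> exists u, w = f u) ->
  nchildren (f v) = nchildren v.
Proof.
move=> fI fP fD.
have fL a b : rlt (f a) (f b) = rlt a b by rewrite /rlt fP (inj_eq fI).
have fC u : is_child (f v) (f u) = is_child v u.
  rewrite /is_child fL; congr (_ && ~~ _); apply/existsP/existsP => -[w].
    move=> /andP[uw wv]; have [x xw] : exists x, w = f x.
      by apply: fD; case/andP: wv.
    by exists x; rewrite -!fL -xw uw.
  by move=> /andP[uw wv]; exists (f w); rewrite !fL uw.
rewrite /nchildren -(card_imset _ fI); apply: eq_card => w; rewrite inE.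
apply/idP/imsetP => [wv|[u uv ->]]; last by rewrite fC; rewrite inE in uv.
have [u uw] : exists u, w = f u by apply: fD; case/andP: wv => /andP[].
by exists u; rewrite // inE -fC -uw.
Qed.

(** The number of roots of a forest, written as a sum of truth values so that it splits along sum
    and option types. *)
Definition nmaximal (P : finRel) : nat := \sum_(u : P) [forall w : P, ~~ rlt u w].

Lemma nmaximal_root (P : finRel) : nmaximal (rel_root P) = 1%N.
Proof.
rewrite /nmaximal big_option big1 => [|u _] /=.
  by rewrite addn0; case: forallP => // -[] [].
by case: forallP => // /(_ None).
Qed.

Lemma nmaximal_sum (P Q : finRel) :
  nmaximal (rel_sum P Q) = (nmaximal P + nmaximal Q)%N.
Proof.
rewrite /nmaximal big_sumType; congr addn; apply: eq_bigr => u _; congr nat_of_bool.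
- apply/forallP/forallP => [h w|h [w|w]]; [exact: (h (inl w))|exact: h|].
  by rewrite /rlt andbF.
- apply/forallP/forallP => [h w|h [w|w]]; [exact: (h (inr w))| |exact: h].
  by rewrite /rlt andbF.
Qed.

Lemma nmaximal_forest (s : seq ptree) : nmaximal (forest_rel s) = size s.
Proof.
elim: s => [|[t] s IHs]; first by apply: big1; case.
by rewrite /= nmaximal_sum IHs /= nmaximal_root.
Qed.

(** An element strictly between [Some u] and [None] is an element of [P] exceeding [u], so [None]
    covers exactly the maximal elements of [P]. *)
Lemma nchildren_root (P : finRel) : nchildren (None : rel_root P) = nmaximal P.
Proof.
rewrite /nchildren -sum1_card big_mkcond big_option inE /nmaximal /= add0n.
apply: eq_bigr => u _; rewrite inE /is_child.
have -> : [exists w : rel_root P, @rlt (rel_root P) (Some u) w && rlt w None]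
          = ~~ [forall w, ~~ rlt u w].
  rewrite negb_forall; apply/existsP/existsP => [[[w|]]|[w]].
  - by rewrite [X in _ && X]/rlt /= andbT => h; exists w; rewrite negbK.
  - by rewrite [X in _ && X]/rlt andbF.
  - by rewrite negbK => h; exists (Some w); rewrite [X in _ && X]/rlt /= andbT.
by rewrite negbK; case: forallP.
Qed.

Section Weights.
Variables (k : fieldType) (p : k).

Lemma gbinom0 : gbinom p 0 = 1.
Proof. by rewrite /gbinom big_ord0 fact0 divr1. Qed.

Lemma CpE (P : finRel) : Cp p P = \prod_(v : P) gbinom p (nchildren v).
Proof.
rewrite /Cp big_mkcond; apply: eq_bigr => v _.
by case: eqP => //= ->; rewrite gbinom0.
Qed.

Lemma Cp_isom (P Q : finRel) : isom P Q -> Cp p P = Cp p Q.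
Proof.
move=> [f fb fP]; rewrite !CpE (reindex f) /=; last exact: onW_bij.
apply: eq_bigr => v _; rewrite (nchildren_embed (bij_inj fb) fP) // => w _.
by have [g _ gK] := fb; exists (g w); rewrite gK.
Qed.

Lemma Cp_sum (P Q : finRel) : Cp p (rel_sum P Q) = Cp p P * Cp p Q.
Proof.
rewrite !CpE big_sumType; congr (_ * _); apply: eq_bigr => v _; congr gbinom.
- apply: (@nchildren_embed P (rel_sum P Q) inl) => //; first by move=> ? ? [].
  by case=> // u _; exists u.
- apply: (@nchildren_embed Q (rel_sum P Q) inr) => //; first by move=> ? ? [].
  by case=> // u _; exists u.
Qed.

Lemma Cp_root (P : finRel) :
  Cp p (rel_root P) = gbinom p (nmaximal P) * Cp p P.
Proof.
rewrite !CpE big_option nchildren_root; congr (_ * _).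
apply: eq_bigr => v _; congr gbinom.
apply: (@nchildren_embed P (rel_root P) Some) => //; first exact: Some_inj.
by case=> // u _; exists u.
Qed.

Lemma Cp_node (s : seq ptree) :
  Cp p (ptree_rel (PNode s)) =
  gbinom p (size s) * \prod_(t <- s) Cp p (ptree_rel t).
Proof.
rewrite /= -/(forest_rel s) Cp_root nmaximal_forest; congr (_ * _).
elim: s => [|t s IHs]; last by rewrite big_cons /= Cp_sum IHs.
by rewrite big_nil CpE big1 //; case.
Qed.

End Weights.

(** * Forests up to isomorphism and grafting *)

Lemma isom_sumCA (A B C : finRel) :
  isom (rel_sum A (rel_sum B C)) (rel_sum B (rel_sum A C)).
Proof.
pose f (X Y Z : finRel) (u : rel_sum X (rel_sum Y Z)) : rel_sum Y (rel_sum X Z) :=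
  match u with
  | inl x => inr (inl x) | inr (inl y) => inl y | inr (inr z) => inr (inr z)
  end.
exists (f A B C); first by exists (f B A C) => [[x|[x|x]]|[x|[x|x]]].
by move=> [x|[x|x]] [y|[y|y]].
Qed.

Lemma isom_forest_insert t s1 s2 :
  isom (forest_rel (s1 ++ t :: s2)) (forest_rel (t :: s1 ++ s2)).
Proof.
elim: s1 => [|u s1 IHs] /=; first exact: isom_refl.
exact: isom_trans (isom_sum (isom_refl _) IHs) (isom_sumCA _ _ _).
Qed.

Lemma rho_eqP (T T' : ptree) : rho T = rho T' <-> isom (ptree_rel T) (ptree_rel T').
Proof.
by split=> [/eqquotP/asboolP //|h]; apply/eqquotP/asboolP.
Qed.

(** By induction on [s]: a tree of [s'] in the class of the head of [s] is moved to the front and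
    matched with that head. *)
Lemma isom_forest (s s' : seq ptree) :
  perm_eq (map rho s) (map rho s') -> isom (forest_rel s) (forest_rel s').
Proof.
elim: s s' => [|t s IHs] s' /= ss'.
  by have := perm_size ss'; case: s' ss' => // _ _; apply: isom_refl.
have /mapP[t' t's' tt'] : rho t \in map rho s' by rewrite -(perm_mem ss') mem_head.
case: (path.splitPr t's') ss' => s1 s2 ss'.
apply: isom_trans (isom_sym (isom_forest_insert t' s1 s2)).
apply: isom_sum; first exact/rho_eqP.
apply: IHs; rewrite -(perm_cons (rho t)) (perm_trans ss') //.
rewrite tt' !map_cat /=.
exact: (permEl (perm_catCA (map rho s1) [:: rho t'] (map rho s2))).
Qed.

Definition monomial (s : seq ptree) : forest := \big[mmul/mone]_(t <- s) ucm (rho t).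

Lemma monomialE (s : seq ptree) u : monomial s u = count_mem u (map rho s).
Proof.
rewrite /monomial; elim: s => [|t s IHs]; rewrite ?big_nil ?big_cons /= ?cm1 //.
by rewrite cmM IHs cmU.
Qed.

Lemma count_forest_seq (m : forest) u : count_mem u (forest_seq m) = m u.
Proof.
rewrite /forest_seq count_flatten sumnE !big_map.
under eq_bigr do rewrite count_nseq.
have [um|um] := boolP (u \in finsupp m).
  rewrite (big_fsetD1 u) //= eqxx mul1n big_seq big1 ?addn0 // => i.
  by rewrite !inE => /andP[/negbTE ->].
rewrite big_seq big1 => [|i im]; first by rewrite -cmE_eq0 in um; rewrite (eqP um).
by rewrite /=; have [iu|//] := eqVneq i u; move: um; rewrite -iu im.
Qed.

(** [graft] chooses an order on the trees and a representative of each; by [isom_forest] neither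
    choice affects the class of the result. *)
Lemma graft_monomial (s : seq ptree) : graft (monomial s) = rho (PNode s).
Proof.
rewrite /graft; apply/rho_eqP => /=; apply: isom_root; apply: isom_forest.
rewrite -map_comp map_id_in => [|t _]; last by rewrite /= /rho reprK.
by apply/allP => u _ /=; rewrite count_forest_seq monomialE.
Qed.

(** * Powers of formal sums as sums over sequences *)

Section Sequences.
Variable T : eqType.

Fixpoint seqs (L : seq T) (j : nat) : seq (seq T) :=
  if j is i.+1 then [seq t :: s | t <- L, s <- seqs L i] else [:: [::]].

Lemma mem_seqs (L : seq T) j s :
  (s \in seqs L j) = (size s == j) && all (mem L) s.
Proof.
elim: j s => [|j IHj] s /=; first by rewrite inE; case: s.
apply/allpairsP/idP => [[[t s'] /= [tL s'L ->]]|].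
  by move: s'L; rewrite IHj /= eqSS tL.
case: s => [|t s] //=; rewrite eqSS => /and3P[sj tL sL].
by exists (t, s); rewrite /= IHj sj.
Qed.

Lemma seqs_uniq (L : seq T) j : uniq L -> uniq (seqs L j).
Proof.
move=> Lu; elim: j => [|j IHj] //=; apply: allpairs_uniq => //.
by move=> [t s] [t' s'] _ _ /= [-> ->].
Qed.

(* The finite list [L] stands for a possibly infinite set of generators: only those
   of size at most [N] matter in degrees at most [N]. *)
Lemma fs_exp_seqs (k : fieldType) (f : nat -> CK k) (L : seq T)
    (sz : T -> nat) (w : T -> CK k) (N : nat) :
    (forall i, (i <= N)%N -> f i = \sum_(t <- L | sz t == i) w t) ->
  forall j n, (n <= N)%N ->
    fs_exp f j n =
    \sum_(s <- seqs L j | (\sum_(t <- s) sz t)%N == n) \prod_(t <- s) w t.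
Proof.
move=> fL; elim=> [|j IHj] n nN.
  by rewrite /= big_cons !big_nil eq_sym addr0 /fs_exp /= /fs_one; case: eqP.
rewrite /= big_mkcond big_allpairs_dep -[LHS]/(fs_mul f (fs_exp f j) n) /fs_mul.
under [LHS]eq_bigr => i _.
  have iN : (i <= N)%N by apply: leq_trans nN; rewrite -ltnS.
  rewrite fL // [X in _ * X]IHj ?(leq_trans (leq_subr _ _)) //.
  rewrite big_mkcond big_distrl /=.
  over.
rewrite exchange_big; apply: eq_bigr => t _ /=.
under [RHS]eq_bigr do rewrite !big_cons.
(* If [sz t] exceeds [n], no index [i] equals it and no sequence starting with [t] has total size
   [n]: both sides vanish. Otherwise only [i = sz t] survives. *)
have [tn|tn] := leqP (sz t) n; last first.
  rewrite !big1 // => [s _|i _].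
    by rewrite gtn_eqF // (leq_trans tn) ?leq_addr.
  by rewrite gtn_eqF ?mul0r // (leq_trans _ tn).
rewrite (bigD1 (inord (sz t))) //= inordK // eqxx [X in _ + X]big1 ?addr0; last first.
  move=> i ti; rewrite (_ : (sz t == i) = false) ?mul0r //.
  by apply: contraNF ti => /eqP ti; apply/eqP/val_inj; rewrite /= inordK.
rewrite big_mkcond big_distrr; apply: eq_bigr => s _ /=.
rewrite -(eqn_add2l (sz t)) subnKC //.
by case: eqP => // _; rewrite mulr0.
Qed.

End Sequences.

(** * The operator [Bplus] and the solution of the equation *)

Section DysonSchwinger.

Lemma scale_malgU (K : choiceType) (R : nzRingType) (c : R) (m : K) :
  c *: (<< m >> : {malg R[K]}) = << c *g m >>.
Proof. by apply/malgP => m'; rewrite mcoeffZ !mcoeffU mulrnAr mulr1. Qed.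

Variables (k : fieldType) (p : k).

Lemma tree_monomial (s : seq ptree) :
  \prod_(t <- s) tree k (rho t) = (<< monomial s >> : {malg k[forest]}).
Proof.
rewrite /monomial; elim: s => [|t s IHs]; first by rewrite !big_nil.
rewrite !big_cons IHs [LHS]malgM_def fgmulUU mulr1; reflexivity.
Qed.

(** Writing [Bplus] as a linear extension from the basis of forests makes its additivity
    available. *)
Lemma BplusE (f : CK k) :
  Bplus f = mmap (@malgC forest k) (fun m => tree k (graft m)) f.
Proof. by apply: eq_bigr => m _; rewrite [RHS]mul_malgC. Qed.

Lemma Bplus_sum (I : Type) (r : seq I) (P : pred I) (F : I -> CK k) :
  Bplus (\sum_(i <- r | P i) F i) = \sum_(i <- r | P i) Bplus (F i).
Proof.
rewrite BplusE raddf_sum; apply: eq_bigr => i _.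
by rewrite BplusE.
Qed.

Lemma Bplus_monomial (c : k) (s : seq ptree) :
  Bplus (c *: \prod_(t <- s) tree k (rho t)) = c *: tree k (rho (PNode s)).
Proof.
rewrite tree_monomial -graft_monomial.
transitivity (Bplus (<< c *g monomial s >> : {malg k[forest]})).
  by congr Bplus; exact: scale_malgU.
rewrite BplusE mmapU; exact: mul_malgC.
Qed.

Definition psize (T : ptree) : nat := #|ptree_rel T|.

Lemma psize_node (s : seq ptree) :
  psize (PNode s) = (\sum_(t <- s) psize t).+1.
Proof.
rewrite /psize /= card_option; congr _.+1.
elim: s => [|t s IHs]; first by rewrite big_nil card_void.
by rewrite big_cons -IHs card_sum.
Qed.

Definition weight (T : ptree) : CK k := Cp p (ptree_rel T) *: tree k (rho T).

Lemma weight_node (s : seq ptree) :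
  weight (PNode s) = Bplus (gbinom p (size s) *: \prod_(t <- s) weight t).
Proof.
by rewrite scaler_prod scalerA -Cp_node Bplus_monomial.
Qed.

Definition tree_sum (n : nat) : CK k :=
  \sum_(t \in rtrees n) ((planar_count t)%:R * Cp p (rtree_rel t)) *: tree k t.

Lemma rsize_rho (T : ptree) : rsize (rho T) = psize T.
Proof. exact: isom_card (rho_rel T). Qed.

(** The coefficient e(t) is spread over the planar trees in the fibre of [rho] above t, on which
    [Cp] is constant. The list [L] may contain trees of other sizes; the sum filters them out. *)
Lemma tree_sum_planar (n : nat) (L : seq ptree) :
    uniq L -> (forall T, psize T = n.+1 -> T \in L) ->
  tree_sum n = \sum_(T <- L | psize T == n.+1) weight T.
Proof.
move=> Lu LP; rewrite /tree_sum fsbig_finite; last exact: finite_rtrees.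
have tE t : t \in fset_set (rtrees n) = (rsize t == n.+1).
  by rewrite in_fset_set; [apply/asboolP/eqP|apply: finite_rtrees].
transitivity (\sum_(t <- fset_set (rtrees n)) \sum_(T <- L | rho T == t) weight T).
  rewrite big_seq [RHS]big_seq; apply: eq_bigr => t; rewrite tE => /eqP tn.
  (* Every planar tree above [t] has [n.+1] vertices, hence lies in [L]. *)
  have -> : planar_count t = count (fun T => rho T == t) L.
    rewrite -size_filter; apply/perm_size/uniq_perm; rewrite ?filter_uniq //.
    move=> T; rewrite in_fset_set; last exact: finite_planar.
    rewrite mem_filter; apply/asboolP/andP => [Tt|[/eqP]] //.
    by split; [apply/eqP|apply: LP; rewrite -rsize_rho Tt].
  rewrite -sum1_count natr_sum mulr_suml scaler_suml.
  apply: eq_bigr => T /eqP <-.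
  by rewrite mul1r (Cp_isom _ (rho_rel T)).
rewrite (exchange_big_dep predT) //= [RHS]big_mkcond; apply: eq_bigr => T _.
have [Tn|Tn] := eqVneq (psize T) n.+1.
  have Tf : rho T \in fset_set (rtrees n) by rewrite tE rsize_rho Tn.
  rewrite big_mkcond (big_fsetD1 _ Tf) /= eqxx big_seq big1 ?addr0 // => t.
  by rewrite !inE eq_sym => /andP[/negbTE ->].
rewrite big_seq_cond big1 // => t /andP[]; rewrite tE => tn /eqP Tt.
by rewrite -Tt rsize_rho (negbTE Tn) in tn.
Qed.

Definition solution (n : nat) : CK k := if n is m.+1 then tree_sum m else 1.

(** Agreement is assumed only up to degree [n], so that the lemma serves both the inductive proof of
    uniqueness and the check that [solution] satisfies the equation. *)
Lemma Bplus_power (X : nat -> CK k) (n : nat) :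
    (forall i, (i <= n)%N -> X i = solution i) ->
  Bplus (fs_power p X n) = solution n.+1.
Proof.
move=> Xn; have [L0 L0P] := ptrees_bounded n; pose L := undup L0.
have Lu : uniq L := undup_uniq _.
have LP T : (psize T <= n)%N -> T \in L by rewrite mem_undup; apply: L0P.
have barE i : (i <= n)%N -> fs_bar X i = \sum_(T <- L | psize T == i) weight T.
  rewrite /fs_bar => i_n; rewrite Xn //; case: i i_n => [|i] i_n /=.
    (* In degree 0 the bar gives 0, and no planar tree is empty. *)
    by rewrite big1 // => -[s]; rewrite psize_node.
  by apply: tree_sum_planar => // T Ti; apply: LP; rewrite Ti.
pose S j := [seq s <- seqs L j | (\sum_(t <- s) psize t)%N == n].
have SE j s : s \in S j -> size s = j.
  by rewrite mem_filter mem_seqs => /and3P[_ /eqP].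
(* The planar trees with [n.+1] vertices are listed by the number [j] of children of the root,
   matching the sum over [j] in [fs_power]. *)
rewrite /= (@tree_sum_planar n [seq PNode s | j <- index_iota 0 n.+1, s <- S j]).
- rewrite big_mkcond big_allpairs_dep Bplus_sum big_mkord.
  apply: eq_bigr => j _; rewrite (fs_exp_seqs barE) // scaler_sumr Bplus_sum.
  rewrite -[LHS]big_filter -/(S j) [LHS]big_seq [RHS]big_seq.
  apply: eq_bigr => s sS; rewrite weight_node (SE _ _ sS) psize_node eqSS.
  by move: sS; rewrite mem_filter => /andP[-> _].
- apply: allpairs_uniq_dep; rewrite ?iota_uniq //.
    by move=> j _; rewrite filter_uniq ?seqs_uniq.
  move=> _ _ /allpairsPdep[j [s [_ sS ->]]] /allpairsPdep[j' [s' [_ s'S ->]]].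
  by case=> /= ss'; move: s'S; rewrite -ss' => /SE <-; rewrite (SE _ _ sS).
- case=> s; rewrite psize_node => -[sn].
  (* Each subtree has at least one vertex, so truncating at [j <= n] loses no tree. *)
  have sz : (size s <= n)%N.
    by rewrite -sn -sum1_size; apply: leq_sum => -[t] _; rewrite psize_node.
  apply/allpairsPdep; exists (size s), s; split=> //.
    by rewrite mem_index_iota.
  rewrite mem_filter sn eqxx mem_seqs eqxx /=; apply/allP => t ts; apply: LP.
  by rewrite -sn (perm_big _ (perm_to_rem ts)) big_cons leq_addr.
Qed.

Lemma homogeneous_tree_sum n : homogeneous n.+1 (tree_sum n).
Proof.
rewrite /tree_sum fsbig_finite; last exact: finite_rtrees.
rewrite big_seq; apply: big_ind => [m|f g fn gn m|t].
- by rewrite msupp0.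
- by move/(fsubsetP (msuppD_le _ _)); rewrite inE => /orP[/fn|/gn].
- rewrite in_fset_set; last exact: finite_rtrees.
  move=> /asboolP tn m /(fsubsetP (msuppZ_le _ _)).
  move=> /(fsubsetP msuppU_le) /fset1P ->.
  by rewrite /fsize mdomU big_seq_fset1 cmUU mul1n.
Qed.

Lemma homogeneous_solution n : homogeneous n (solution n).
Proof.
case: n => [|n]; last exact: homogeneous_tree_sum.
move=> m /(fsubsetP msuppU_le) /fset1P ->.
by rewrite /fsize mdom1 big_seq_fset0.
Qed.

Lemma DSE_solutionP (X : nat -> CK k) : DSE_solution p X <-> X = solution.
Proof.
split=> [[_ X0 XE]|->].
  apply/funext => n; elim/ltn_ind: n => -[|n] IHn //.
  rewrite XE /fs_add /fs_one /= add0r; apply: Bplus_power => i i_n.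
  exact: IHn.
split=> //; first exact: homogeneous_solution.
apply/funext => -[|n]; first by rewrite /fs_add addr0.
by rewrite /fs_add /fs_one add0r /= Bplus_power.
Qed.

End DysonSchwinger.

Theorem theorem6p2 (R : realType) (k : fieldType) (char0 : [pchar k]%R =i pred0)
    (iota : {rmorphism R -> k}%R) (p : R) (X : nat -> CK k) :
  DSE_solution (iota p) X <->
  X 0%N = 1%R /\
  forall n : nat, (1 <= n)%N ->
    X n = (\sum_(t \in rtrees n.-1)
             ((planar_count t)%:R * Cp (iota p) (rtree_rel t)) *: tree k t)%R.
Proof.
apply: (iff_trans (DSE_solutionP _ _)); split=> [->|[X0 XE]].
  by split=> // -[].
by apply/funext => -[|n] //; rewrite XE.
Qed.
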